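(* Let $0<c<1$. For each prime $p$ let $N=N(p)$ be a positive integer and $t=t(p)\in\mathbb F_p$, where $\lim_{p\to\infty}N(p)=\infty$ and $N=o(p^{1/3})$. Let \[B=\{a+bt:\ a,b\in\mathbb Z,\ |a|,|b|\leq N\}\subset\mathbb F_p\] be proper, and assume $|B|=o(p^{2/3})$. Suppose that \[A=\{a'+b't:\ a',b'\in\mathbb Z,\ |a'|,|b'|\leq cN^{1/2}\}\] satisfies $AA\subset B$. Then there is a constant $C$ depending only on $c$ such that, when $p$ is sufficiently large, there exists a quadratic polynomial $f\in\mathbb Z[x]\setminus\{0\}$ with $H(f)\leq C$ and $\overline f(t)=0$ in $\mathbb F_p$.
   Context: $p$ denotes a prime and $\mathbb F_p$ the field with $p$ elements; integers are viewed in $\mathbb F_p$ via reduction mod $p$. The set $B$ is called proper if $|B|=(2N+1)^2$, i.e. the elements $a+bt$ with $|a|,|b|\le N$ are pairwise distinct. For sets $X,Y\subset\mathbb F_p$, $XY=\{xy:x\in X,y\in Y\}$. For $f\in\mathbb Z[x]$, $H(f)$ is the maximum absolute value of the coefficients of $f$, and $\overline f\in\mathbb F_p[x]$ is the reduction of $f$ mod $p$. *)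

(* Defs.v *)
From HB Require Import structures.
From mathcomp Require Import all_boot all_order all_algebra.
From mathcomp Require Import all_classical all_reals all_analysis.

Set Implicit Arguments.
Unset Strict Implicit.
Unset Printing Implicit Defensive.

Import Order.TTheory GRing.Theory Num.Theory.
Import numFieldNormedType.Exports.

Local Open Scope ring_scope.

(* The filter "p --> oo along the primes". *)
Notation primes_oo := (within (fun p : nat => is_true (prime p)) \oo%classic).

(* A single definition covers both B (r = N) and A (r = c N^(1/2)). *)
Definition gap2 (R : realType) (p : nat) (r : R) (t : 'F_p) : {set 'F_p} :=
  [set x : 'F_p | `[< exists a b : int,
     [/\ `|a|%:~R <= r, `|b|%:~R <= r & x = a%:~R + b%:~R * t] >]].

Definition prodset (p : nat) (X Y : {set 'F_p}) : {set 'F_p} :=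
  [set x * y | x in X, y in Y].

Definition height (f : {poly int}) : nat := (\max_(i < size f) absz (f`_i)%R)%N.

(* Main.v *)
(** A relation [t^2 = x + y t] with [|x|, |y| <= N] exists because [t \in A].
    If [a + b t = 0] with [|a|, |b| <= 3N], then [a^2 + a b y - b^2 x] is
    divisible by [p] and has size at most [27 N^3 < p], so it vanishes over the
    integers; if [b != 0] then [s = a / b] is an integer root of
    [X^2 + y X - x], hence [|s| <= N], and [s + t = 0] contradicts properness.
    So relations of size [3N] are trivial. Comparing the
    representations of [i j t^2] and [i (j+1) t^2] in [B], this shows
    that [i j t^2 = i j x + i j y t] is the representation given by
    [AA \subset B] for all [i, j <= c N^(1/2)]. Hence
    [|x|, |y| <= N / M^2 = O(c^-2)] with [M] the integer part of [c N^(1/2)]. *)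
Require Import Defs.
From HB Require Import structures.
From mathcomp Require Import all_boot all_order all_algebra.
From mathcomp Require Import all_classical all_reals all_analysis.
From mathcomp Require Import zify ring lra.

Set Implicit Arguments.
Unset Strict Implicit.
Unset Printing Implicit Defensive.

Import Order.TTheory GRing.Theory Num.Theory.
Import numFieldNormedType.Exports.

Local Open Scope ring_scope.

(** * Integers modulo [p] and rational roots of monic quadratics *)

Lemma Fp_intr_eq0 (p : nat) (z : int) :
  prime p -> (z%:~R == 0 :> 'F_p) = (p %| `|z|)%N.
Proof.
move=> p_pr; have chp := pchar_Fp p_pr.
by case: z => n; rewrite ?NegzE ?mulrNz ?oppr_eq0 ?abszN -pmulrn
  -(dvdn_pcharf chp).
Qed.

Lemma Fp_intr_small_eq0 (p : nat) (z : int) :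
  prime p -> `|z| < p%:Z -> z%:~R = 0 :> 'F_p -> z = 0.
Proof.
move=> p_pr ltzp /eqP; rewrite Fp_intr_eq0 // => pz.
apply/eqP; rewrite -absz_eq0 eqn0Ngt; apply/negP=> z0.
have := dvdn_leq z0 pz; lia.
Qed.

(** The discriminant satisfies [b^2 (y^2 + 4x) = (2a + by)^2], so [b] divides [2a + by] and hence
    [2a]. The quotient [k] is even, since [k (k + 2y) = 4x] is even. *)
Lemma rational_root_integral (a b x y : int) :
  b != 0 -> a ^+ 2 + a * b * y = b ^+ 2 * x ->
  exists2 s : int, a = s * b & s * (s + y) = x.
Proof.
move=> b0 eqab.
have sq_dvd : (b ^+ 2 %| (2%:Z * a + b * y) ^+ 2)%Z.
  apply/dvdzP; exists (y ^+ 2 + 4%:Z * x).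
  have -> : (y ^+ 2 + 4%:Z * x) * b ^+ 2 = b ^+ 2 * y ^+ 2 + 4%:Z * (b ^+ 2 * x).
    by ring.
  by rewrite -eqab; ring.
have /dvdzP[k ek] : (b %| 2%:Z * a)%Z.
  by move: sq_dvd; rewrite dvdz_pexp2r // rpredDr // dvdz_mulr.
have eqk : k * (k + 2%:Z * y) = 4%:Z * x.
  apply: (mulIf (expf_neq0 2 b0)).
  transitivity ((k * b) ^+ 2 + 2%:Z * (k * b) * b * y); first by ring.
  rewrite -ek; transitivity (4%:Z * (a ^+ 2 + a * b * y)); first by ring.
  by rewrite eqab; ring.
have [s es] : exists s, k = 2%:Z * s.
  have [s [ks|ks]] : exists s, k = 2%:Z * s \/ k = 2%:Z * s + 1.
  - by exists (k %/ 2)%Z; lia.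
  - by exists s.
  - by move: eqk; rewrite ks; lia.
exists s; first by move: ek; rewrite es; lia.
by move: eqk; rewrite es; lia.
Qed.

(** * Uniqueness of small representations *)

Section Proper.
Variables (p N : nat) (t : 'F_p) (x y : int).
Hypothesis p_pr : prime p.
Hypothesis N_small : (27 * N ^ 3 < p)%N.
Hypothesis proper : forall s : int, `|s| <= N%:Z -> s%:~R + t != 0.
Hypotheses (x_le : `|x| <= N%:Z) (y_le : `|y| <= N%:Z).
Hypothesis tt : t ^+ 2 = x%:~R + y%:~R * t.

Lemma small_relation_trivial (a b : int) :
  `|a| <= 3%:Z * N%:Z -> `|b| <= 3%:Z * N%:Z -> a%:~R + b%:~R * t = 0 ->
  a = 0 /\ b = 0.
Proof.
move=> ale ble ab0.
(* This is the norm of [a + b T] for a root [T] of [X^2 - y X - x]. Modulo [p], putting [a = - b t]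
   turns it into [b^2 (t^2 - y t - x) = 0]. *)
have norm0 : a ^+ 2 + a * b * y - b ^+ 2 * x = 0.
  apply: (Fp_intr_small_eq0 p_pr).
    have M : forall u v U V : int, `|u| <= U -> `|v| <= V -> `|u * v| <= U * V.
      by move=> u v U V uU vV; rewrite normrM ler_pM.
    have aa := M _ _ _ _ ale ale; have ab := M _ _ _ _ ale ble.
    have bb := M _ _ _ _ ble ble.
    have aby := M _ _ _ _ ab y_le; have bbx := M _ _ _ _ bb x_le.
    rewrite !expr2; nia.
  have ea : a%:~R = - (b%:~R * t) by apply/eqP; rewrite -addr_eq0 ab0.
  rewrite !(rmorphB, rmorphD, rmorphM, rmorphXn) /= ea.
  have -> : x%:~R = t ^+ 2 - y%:~R * t by rewrite tt addrK.
  by ring.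
have [b0|b0] := eqVneq b 0.
  split=> //; move: norm0; rewrite b0 mulr0 mul0r addr0 expr0n mul0r subr0.
  by move/eqP; rewrite expf_eq0 => /eqP.
have [s es sx] := rational_root_integral b0 (subr0_eq norm0).
(* If [|s| > N], then [s + y] is nonzero because [|y| <= N], so [|s (s + y)| > N >= |x|]. *)
have sN : `|s| <= N%:Z.
  nia.
have := proper sN; have : b%:~R * (s%:~R + t) = 0.
  by rewrite -ab0 es rmorphM /=; ring.
move/eqP; rewrite mulf_eq0 => /orP[/eqP|->//] bp _.
have bs : `|b| < p%:Z by nia.
by move: b0; rewrite (Fp_intr_small_eq0 p_pr bs bp).
Qed.

(** Induction on [j]: if [(j u, j v)] is within [N], then [((j+1) u, (j+1) v)] is within [2N], so it
    differs from the given representation of [(j+1) z] by a relation of size at most [3N], which is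
    trivial. *)
Lemma multiples_small_coords (M : nat) (z : 'F_p) (u v : int) :
  z = u%:~R + v%:~R * t -> `|u| <= N%:Z -> `|v| <= N%:Z ->
  (forall j : nat, (j <= M)%N -> exists u' v' : int,
     [/\ `|u'| <= N%:Z, `|v'| <= N%:Z & j%:R * z = u'%:~R + v'%:~R * t]) ->
  M%:Z * `|u| <= N%:Z /\ M%:Z * `|v| <= N%:Z.
Proof.
move=> ez ule vle rep.
suff: forall j : nat, (j <= M)%N ->
    `|j%:Z * u| <= N%:Z /\ `|j%:Z * v| <= N%:Z.
  by move=> /(_ M (leqnn M)); rewrite !normrM.
elim=> [|j IH] jM; first by rewrite !mul0r normr0.
have [ju jv] := IH (ltnW jM).
have [u' [v' [u'le v'le e]]] := rep _ jM.
have [|||eu ev] :=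
  @small_relation_trivial (u' - j%:Z * u - u) (v' - j%:Z * v - v).
- lia.
- lia.
- rewrite !(rmorphB, rmorphM) /= -!pmulrn.
  have -> : u'%:~R = j.+1%:R * z - v'%:~R * t by rewrite e addrK.
  by rewrite ez -natr1; ring.
have -> : j.+1%:Z * u = u' by lia.
by have -> : j.+1%:Z * v = v' by lia.
Qed.

End Proper.

(** * From the cardinality and growth hypotheses to integer inequalities *)

Lemma gap2_coords (R : realType) (p N : nat) (t z : 'F_p) :
  z \in gap2 (N%:R : R) t -> exists a b : int,
    [/\ `|a| <= N%:Z, `|b| <= N%:Z & z = a%:~R + b%:~R * t].
Proof.
rewrite inE => /asboolP[a [b [ale ble ->]]]; exists a, b.
by rewrite -!(ler_int R) -!pmulrn.
Qed.

(** The parametrization [F] by [(2N+1)^2] index pairs, shifted by [N], covers a set of that size, so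
    it is injective. If [s + t = 0], the coefficient pairs [(s, 1)] and [(0, 0)] would collide;
    [N > 0] keeps the coefficient 1 in range. *)
Lemma gap2_proper_neq0 (R : realType) (p N : nat) (t : 'F_p) (s : int) :
  #|gap2 (N%:R : R) t| = ((2 * N + 1) ^ 2)%N -> `|s| <= N%:Z -> (0 < N)%N ->
  s%:~R + t != 0.
Proof.
move=> cardB sN N0; apply/eqP => st0.
pose I := 'I_(2 * N + 1).
pose F (ij : I * I) : 'F_p :=
  (ij.1%:Z - N%:Z)%:~R + (ij.2%:Z - N%:Z)%:~R * t.
have subF : gap2 (N%:R : R) t \subset F @: [set: I * I].
  apply/fintype.subsetP => z /gap2_coords[a [b [ale ble ->]]].
  have ia : (`|(a + N%:Z)%R| < 2 * N + 1)%N by lia.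
  have ib : (`|(b + N%:Z)%R| < 2 * N + 1)%N by lia.
  apply/imsetP; exists (Ordinal ia, Ordinal ib); rewrite ?inE //.
  by rewrite /F /=; congr (_%:~R + _%:~R * _); lia.
have cardI : #|[set: I * I]| = ((2 * N + 1) ^ 2)%N.
  by rewrite cardsT card_prod card_ord.
have /imset_injP injF : #|F @: [set: I * I]| == #|[set: I * I]|.
  by rewrite eqn_leq leq_imset_card cardI -cardB subset_leq_card.
have i0 : (N < 2 * N + 1)%N by lia.
have i1 : (N.+1 < 2 * N + 1)%N by lia.
have iS : (`|(s + N%:Z)%R| < 2 * N + 1)%N by lia.
have := injF (Ordinal iS, Ordinal i1) (Ordinal i0, Ordinal i0).
rewrite !inE => /(_ isT isT) eqF.
suff /eqF eq_ij : F (Ordinal iS, Ordinal i1) = F (Ordinal i0, Ordinal i0).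
  by have /= := congr1 (fun ij : I * I => val ij.2) eq_ij; lia.
rewrite /F /= subrr mul0r addr0 -[RHS]st0.
have -> : `|(s + N%:Z)%R|%:Z - N%:Z = s by lia.
have -> : N.+1%:Z - N%:Z = 1 by lia.
by rewrite mul1r.
Qed.

Lemma natr_small_cube (R : realType) (N p : nat) :
  (N%:R : R) <= 4^-1 * (p%:R `^ (1 / 3)) -> (64 * N ^ 3 <= p)%N.
Proof.
move=> le; have le3 : (N%:R : R) ^+ 3 <= (4^-1 * (p%:R `^ (1 / 3))) ^+ 3.
  by rewrite lerXn2r ?nnegrE ?mulr_ge0 ?powR_ge0.
have e3 : ((p%:R : R) `^ (1 / 3)) ^+ 3 = p%:R.
  by rewrite -powR_mulrn ?powR_ge0 // -powRrM div1r mulVf ?powRr1.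
rewrite -(ler_nat R) natrM natrX; move: le3; rewrite exprMn e3.
by lra.
Qed.

Lemma within_prime_nearP (P : nat -> Prop) :
  (\forall p \near primes_oo, P p)%classic ->
  exists p0, forall p, prime p -> (p0 <= p)%N -> P p.
Proof.
by case=> p0 _ Pp; exists p0 => p p_pr /Pp; apply.
Qed.

Lemma monic_quadratic_size_height (x y : int) (f := 'X^2 - y *: 'X - x%:P) :
  size f = 3%N /\ (height f <= maxn 1 (maxn `|x| `|y|))%N.
Proof.
have sz : size f = 3%N.
  have -> : f = 'X^2 + (- (y *: 'X) - x%:P) by rewrite /f addrA.
  rewrite size_polyDl size_polyXn // -opprD size_polyN.
  apply: leq_ltn_trans (size_polyD _ _) _; rewrite gtn_max.
  rewrite (leq_ltn_trans (size_scale_leq _ _)) ?size_polyX //.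
  by rewrite (leq_ltn_trans (size_polyC_leq1 _)).
split=> //; apply/bigmax_leqP => -[i]; rewrite sz => i3 _ /=.
rewrite /f !(coefB, coefZ, coefXn, coefX, coefC).
by case: i i3 => [|[|[|]]] //= _; lia.
Qed.

Theorem theorem2 (R : realType) (c : R) (hc0 : 0 < c) (hc1 : c < 1) :
  exists C : R,
  forall (N : nat -> nat) (t : forall p : nat, 'F_p),
  (forall p, prime p -> (0 < N p)%N) ->
  (N @ primes_oo --> \oo)%classic ->
  (fun p : nat => (N p)%:R : R) =o_primes_oo
    (fun p : nat => p%:R `^ (1 / 3) : R) ->
  (fun p : nat => #|gap2 ((N p)%:R : R) (t p)|%:R : R) =o_primes_oo
    (fun p : nat => p%:R `^ (2 / 3) : R) ->
  exists p0 : nat, forall p : nat, prime p -> (p0 <= p)%N ->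
    let B := gap2 ((N p)%:R : R) (t p) in
    let A := gap2 (c * Num.sqrt ((N p)%:R : R)) (t p) in
    #|B| = ((2 * N p + 1) ^ 2)%N ->
    prodset A A \subset B ->
    exists f : {poly int},
      [/\ f != 0, size f = 3%N, (height f)%:R <= C
        & (map_poly (intr : int -> 'F_p) f).[t p] = 0].
Proof.
(* With [r = c N^(1/2)] and [r <= 2M], the bound [M^2 |x| <= N = r^2 / c^2 <= 4 M^2 / c^2] gives
   this constant. *)
exists (4 / c ^+ 2) => N t N_gt0 N_oo N_o _.
(* [N >= 4 / c^2] forces [r >= 2], whence [M > r - 1 >= r / 2]. *)
have [p1 N_big] : exists p0, forall p, prime p -> (p0 <= p)%N ->
    ((Num.truncn (4 / c ^+ 2)).+1 <= N p)%N.
  by apply: within_prime_nearP; exact: N_oo _ (nbhs_infty_ge _).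
(* Cubing with the factor [1/4] gives [64 N^3 <= p], enough for [27 N^3 < p] as [N > 0]. *)
have [p2 N_small] : exists p0, forall p, prime p -> (p0 <= p)%N ->
    `|(N p)%:R : R| <= 4^-1 * `|p%:R `^ (1 / 3)|.
  by apply: within_prime_nearP; move/eqoP: N_o; apply; rewrite invr_gt0.
exists (maxn p1 p2) => p p_pr; rewrite geq_max => /andP[p1p p2p] B A cardB AAB.
have {N_gt0} N0 := N_gt0 p p_pr.
have {N_small p2p} N_small : (27 * N p ^ 3 < p)%N.
  have := N_small p p_pr p2p; rewrite !ger0_norm ?powR_ge0 // => /natr_small_cube.
  by have : (0 < N p ^ 3)%N; [rewrite expn_gt0 N0 | lia].
have {N_big p1p} N_big : 4 / c ^+ 2 <= (N p)%:R.
  apply: ltW; apply: lt_le_trans (truncnS_gt _) _.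
  by rewrite ler_nat; exact: N_big.
set r := c * Num.sqrt (N p)%:R in A AAB *.
have r2 : r ^+ 2 = c ^+ 2 * (N p)%:R by rewrite exprMn sqr_sqrtr.
have c2_gt0 : 0 < c ^+ 2 by rewrite exprn_gt0.
have r_ge2 : 2 <= r.
  have r_ge0 : 0 <= r by rewrite mulr_ge0 ?sqrtr_ge0 ?ltW.
  rewrite -(@ler_pXn2r _ 2) ?nnegrE // r2.
  by move: N_big; rewrite ler_pdivrMr // mulrC; lra.
pose M := Num.truncn r.
have Mr : M%:R <= r by rewrite truncn_le; lra.
have rM : r < M%:R + 1 by rewrite natr1 truncnS_gt.
have proper s : `|s| <= (N p)%:Z -> s%:~R + t p != 0.
  by move=> sN; exact: gap2_proper_neq0 cardB sN N0.
have inA i : (i <= M)%N -> i%:R * t p \in A.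
  move=> iM; rewrite inE; apply/asboolP; exists 0, i%:Z.
  rewrite normr0 add0r -pmulrn; split=> //; first by lra.
  by rewrite ger0_norm // -pmulrn (le_trans _ Mr) // ler_nat.
have rep i j : (i <= M)%N -> (j <= M)%N -> exists a b : int,
    [/\ `|a| <= (N p)%:Z, `|b| <= (N p)%:Z &
      j%:R * (i%:R * t p ^+ 2) = a%:~R + b%:~R * t p].
  move=> iM jM; apply: (@gap2_coords R); apply: (fintype.subsetP AAB).
  apply/imset2P; exists (i%:R * t p) (j%:R * t p); rewrite ?inA //.
  by ring.
have M1 : (1 <= M)%N by rewrite -(ltr_nat R); lra.
have [x [y [xN yN tt]]] := rep 1%N 1%N M1 M1; rewrite !mul1r in tt.
have relM := multiples_small_coords p_pr N_small proper xN yN tt.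
(* Two rounds, each gaining a factor [M]: first the multiples of [t^2], then those of [M t^2], whose
   coordinates [(M x, M y)] the first round has put within [N]. *)
have [Mx My] : M%:Z * `|x| <= (N p)%:Z /\ M%:Z * `|y| <= (N p)%:Z.
  apply: relM tt xN yN _ => j jM.
  by have := rep 1%N j M1 jM; rewrite mul1r.
have [MMx MMy] : M%:Z * `|M%:Z * x| <= (N p)%:Z /\
    M%:Z * `|M%:Z * y| <= (N p)%:Z.
  apply: (relM _ (M%:R * t p ^+ 2)); rewrite ?normrM //.
    by rewrite tt !rmorphM /= -!pmulrn; ring.
  by move=> j jM; exact: rep.
have bound (z : int) : M%:Z * `|M%:Z * z| <= (N p)%:Z -> `|z|%N%:R <= 4 / c ^+ 2 :> R.
  move=> Mz; have : (M * M * `|z| <= N p)%N by lia.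
  rewrite -(ler_nat R) !natrM => MzR.
  rewrite ler_pdivlMr //.
  have MM : r ^+ 2 <= 4 * (M%:R * M%:R) by nra.
  have NR : 0 < (N p)%:R :> R by rewrite ltr0n.
  rewrite -(ler_pM2r NR) -mulrA -r2.
  have z0 : 0 <= `|z|%N%:R :> R by [].
  by nra.
have [szf htf] := monic_quadratic_size_height x y.
exists ('X^2 - y *: 'X - x%:P); split=> //.
- by rewrite -size_poly_eq0 szf.
(* The leading coefficient 1 also counts in the height; [c < 1] makes the constant large enough. *)
- have C1 : 1 <= 4 / c ^+ 2.
    by rewrite ler_pdivlMr // mul1r; nra.
  have : (height ('X^2 - y *: 'X - x%:P))%:R <= (maxn 1 (maxn `|x| `|y|))%:R :> R.
    by rewrite ler_nat.
  move=> /le_trans; apply; rewrite /maxn.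
  by do ! case: ifP => _ //; apply: bound.
- rewrite !(rmorphB, rmorphXn) /= map_polyZ map_polyX map_polyC /=.
  by rewrite !(hornerE, hornerXn) tt; ring.
Qed.
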